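(* Let $k$ be an odd natural number, let $\phi$ be a contactomorphism of $(\mathbb{R}^{2n+1},\xi_0)$ and let $F:\mathbb{R}^{2n+1}\times\mathbb{R}^N\to\mathbb{R}$ be a generating function of $\phi$. Consider the function $\mathcal{P}_F^{(k)}:\mathbb{R}^{(2n+2)k}\times\mathbb{R}^{Nk}\to\mathbb{R}$ defined by \[ \mathcal{P}_F^{(k)}(x_1,y_1,\theta_1,r_1,\dots,x_k,y_k,\theta_k,r_k,\zeta_1,\dots,\zeta_k) \] \[ =\frac{k}{\sum_{j=1}^ke^{r_j}}\sum_{j=1}^k\Big[e^{r_j}F\Big(e^{-\frac{r_j}2}\tfrac{x_j+x_{j+1}}2,\,e^{-\frac{r_j}2}\tfrac{y_j+y_{j+1}}2,\,\theta_{j+1},\,\zeta_j\Big)+\tfrac12(x_jy_{j+1}-x_{j+1}y_j)+e^{r_{j-1}}(\theta_j-\theta_{j+1})\Big] \] (indices cyclic mod $k$), which is invariant under the $\mathbb{R}$-action in which $c\in\mathbb{R}$ sends each $(x_j,y_j,\theta_j,r_j,\zeta_j)$ to $(e^{c/2}x_j,e^{c/2}y_j,\theta_j,r_j+c,\zeta_j)$. Then the $\mathbb{R}$-orbits of critical points of $\mathcal{P}_F^{(k)}$ are in 1--1 correspondence with the translated $k$-chains of $\phi$, with critical values given by the action: the critical value of an orbit equals the action of the corresponding translated $k$-chain.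
   Context: $\mathbb{R}^{2n+1}$ has coordinates $(x,y,\theta)$, $x,y\in\mathbb{R}^n$ (products of vectors are scalar products), contact form $\alpha_0=d\theta-\sum_j\frac{x_jdy_j-y_jdx_j}2$, $\xi_0=\ker\alpha_0$, Reeb flow $\varphi^{\alpha_0}_t(x,y,\theta)=(x,y,\theta+t)$. The conformal factor of a contactomorphism $\phi$ is the function $g$ with $\phi^*\alpha_0=e^g\alpha_0$. A translated $k$-chain of action $tk$ of $\phi$ (with $t\in\mathbb{R}$) is a $k$-tuple $(p_1,\dots,p_k)$ of points of $\mathbb{R}^{2n+1}$ with $g(p_1)+\dots+g(p_k)=0$ and $p_{j+1}=\varphi^{\alpha_0}_{-t}\circ\phi(p_j)$ for all $j$, with $p_{k+1}=p_1$. A smooth $F:\mathbb{R}^{2n+1}\times\mathbb{R}^N\to\mathbb{R}$ is a generating function if $0$ is a regular value of the fibre derivative $\partial_\zeta F$; then $\Sigma_F=\{\partial_\zeta F=0\}$ is a submanifold and $\widetilde{i_F}:\Sigma_F\to J^1\mathbb{R}^{2n+1}=T^*\mathbb{R}^{2n+1}\times\mathbb{R}$, $(q,\zeta)\mapsto(q,\partial_qF(q,\zeta),F(q,\zeta))$, is a Legendrian immersion. $F$ is a generating function of $\phi=(\phi_x,\phi_y,\phi_\theta)$ if $\widetilde{i_F}$ is an embedding whose image is the Legendrian submanifold $\Lambda_\phi$, the image of $\Gamma_\phi(x,y,\theta)=\big(\frac{e^{g/2}x+\phi_x}2,\frac{e^{g/2}y+\phi_y}2,\theta,\;e^{g/2}y-\phi_y,\phi_x-e^{g/2}x,e^g-1,\;\phi_\theta-\theta+\frac{e^{g/2}(y\phi_x-x\phi_y)}2\big)$,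 where $g,\phi_x,\phi_y,\phi_\theta$ are evaluated at $(x,y,\theta)$; the first three entries are the base point, the next three the covector, the last the $\mathbb{R}$-coordinate. *)

(* Defs.v *)
From mathcomp Require Import all_boot all_order all_algebra.
From mathcomp Require Import all_classical all_reals all_analysis.
Set Implicit Arguments.
Unset Strict Implicit.
Unset Printing Implicit Defensive.
Import Order.TTheory GRing.Theory Num.Theory.
Import numFieldNormedType.Exports.
Local Open Scope classical_set_scope.
Local Open Scope ring_scope.

(** ** Smooth maps *)

(* For finite-dimensional V this is the usual class C^m; it is not meant for
   other V. *)
Fixpoint Cn (R : realType) (V W : normedModType R) (m : nat) (f : V -> W) :
    Prop :=
  if m is m'.+1 then
    (forall x, differentiable f x) /\ (forall v, Cn m' (fun x => 'D_v f x))
  else continuous f.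

Definition smooth (R : realType) (V W : normedModType R) (f : V -> W) : Prop :=
  forall m, Cn m f.

Definition diffeomorphism (R : realType) (V W : normedModType R) (f : V -> W) :
    Prop :=
  smooth f /\ exists h : W -> V, [/\ smooth h, cancel f h & cancel h f].

Definition critical_point (R : realType) (V : normedModType R) (f : V -> R)
    (z : V) : Prop :=
  differentiable f z /\ forall v, 'd f z v = 0.

Definition regular_value (R : realType) (V W : normedModType R) (f : V -> W)
    (c : W) : Prop :=
  forall z, f z = c -> forall w, exists v, 'd f z v = w.

(* For a submanifold S = f^-1(c), with c a regular value of f, the tangent
   space at z is the kernel of 'd f z.  The map i, defined and smooth on the
   ambient space, restricts to an embedding of S: an immersion that is a
   homeomorphism onto its image. *)
Definition embedding_of_level (R : realType) (V W U : normedModType R)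
    (f : V -> W) (c : W) (i : V -> U) : Prop :=
  let S := [set z | f z = c] in
  [/\ forall z, S z ->
        differentiable i z /\
        (forall v, 'd f z v = 0 -> 'd i z v = 0 -> v = 0),
      set_inj S i,
      {within S, continuous i}
    & exists2 h : U -> V,
        (forall z, S z -> h (i z) = z) & {within i @` S, continuous h}].

(** ** The contact manifold R^(2n+1) *)

Definition dot (R : realType) (n : nat) (u v : 'rV[R]_n) : R :=
  \sum_i u ord0 i * v ord0 i.

(* Points ((x, y), theta) of R^(2n+1); also used for tangent vectors and for
   covectors, by their components in the coordinates (x, y, theta). *)
Notation pt R n := ('rV[R]_n * 'rV[R]_n * R)%type (only parsing).

Definition xcoord (R : realType) n (p : pt R n) : 'rV[R]_n := p.1.1.
Definition ycoord (R : realType) n (p : pt R n) : 'rV[R]_n := p.1.2.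
Definition tcoord (R : realType) n (p : pt R n) : R := p.2.

Definition alpha0 (R : realType) n (p v : pt R n) : R :=
  tcoord v
  - (dot (xcoord p) (ycoord v) - dot (ycoord p) (xcoord v)) / 2.

Definition reeb_flow (R : realType) n (t : R) (p : pt R n) : pt R n :=
  (xcoord p, ycoord p, tcoord p + t).

Definition contactomorphism (R : realType) n (phi : pt R n -> pt R n) : Prop :=
  diffeomorphism phi /\
  forall p v, alpha0 p v = 0 <-> alpha0 (phi p) ('d phi p v) = 0.

(* The condition determines g, since alpha0 p is never the zero functional;
   smoothness of g follows from that of phi. *)
Definition conformal_factor (R : realType) n (phi : pt R n -> pt R n)
    (g : pt R n -> R) : Prop :=
  forall p v, alpha0 (phi p) ('d phi p v) = expR (g p) * alpha0 p v.

(* The translated k-chains of action t * k; p_1, ..., p_k are p indexed by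
   'I_k, and ordS is the cyclic successor. *)
Definition translated_chain (R : realType) n k (phi : pt R n -> pt R n)
    (g : pt R n -> R) (t : R) (p : 'I_k -> pt R n) : Prop :=
  \sum_j g (p j) = 0 /\ forall j, p (ordS j) = reeb_flow (- t) (phi (p j)).

(** ** Generating functions *)

Section GeneratingFunctions.
Context (R : realType) (n N : nat).
Implicit Types (F : pt R n * 'rV[R]_N -> R) (z : pt R n * 'rV[R]_N).

Definition fibre_derivative F z : 'rV[R]_N :=
  \row_i 'd F z (0, delta_mx ord0 i).

Definition base_derivative F z : pt R n :=
  (\row_i 'd F z ((delta_mx ord0 i, 0, 0), 0),
   \row_i 'd F z ((0, delta_mx ord0 i, 0), 0),
   'd F z ((0, 0, 1), 0)).

Definition generating_function F : Prop :=
  smooth F /\ regular_value (fibre_derivative F) 0.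

(* J^1 R^(2n+1): base point, covector, value. *)
Definition i_F F z : pt R n * pt R n * R := (z.1, base_derivative F z, F z).

Definition Gamma (phi : pt R n -> pt R n) (g : pt R n -> R) (p : pt R n) :
    pt R n * pt R n * R :=
  let x := xcoord p in
  let y := ycoord p in
  let theta := tcoord p in
  let e := expR (g p / 2) in
  let phix := xcoord (phi p) in
  let phiy := ycoord (phi p) in
  let phit := tcoord (phi p) in
  ((2^-1 *: (e *: x + phix), 2^-1 *: (e *: y + phiy), theta),
   (e *: y - phiy, phix - e *: x, expR (g p) - 1),
   phit - theta + e * (dot y phix - dot x phiy) / 2).

Definition generating_function_of (phi : pt R n -> pt R n) (g : pt R n -> R)
    F : Prop :=
  [/\ generating_function F,
      embedding_of_level (fibre_derivative F) 0 (i_F F)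
    & i_F F @` [set z | fibre_derivative F z = 0] = range (Gamma phi g)].

End GeneratingFunctions.

(** ** The function P_F^(k) *)

(* R^((2n+2)k) x R^(Nk): the j-th rows of the five blocks are x_j, y_j,
   theta_j, r_j and zeta_j. *)
Notation config R n N k :=
  ('M[R]_(k, n) * 'M[R]_(k, n) * 'cV[R]_k * 'cV[R]_k * 'M[R]_(k, N))%type
  (only parsing).

Section ChainFunction.
Context (R : realType) (n N k : nat).
Implicit Types (w : config R n N k) (j : 'I_k).

Definition cx w j : 'rV[R]_n := row j w.1.1.1.1.
Definition cy w j : 'rV[R]_n := row j w.1.1.1.2.
Definition ctheta w j : R := w.1.1.2 j ord0.
Definition cr w j : R := w.1.2 j ord0.
Definition czeta w j : 'rV[R]_N := row j w.2.

Definition P_F (F : pt R n * 'rV[R]_N -> R) w : R :=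
  k%:R / (\sum_j expR (cr w j)) *
  \sum_j
    (expR (cr w j) *
       F ((expR (- (cr w j / 2)) *: (2^-1 *: (cx w j + cx w (ordS j))),
           expR (- (cr w j / 2)) *: (2^-1 *: (cy w j + cy w (ordS j))),
           ctheta w (ordS j)),
          czeta w j)
     + 2^-1 * (dot (cx w j) (cy w (ordS j)) - dot (cx w (ordS j)) (cy w j))
     + expR (cr w (ord_pred j)) * (ctheta w j - ctheta w (ordS j))).

Definition R_action (c : R) w : config R n N k :=
  (expR (c / 2) *: w.1.1.1.1, expR (c / 2) *: w.1.1.1.2, w.1.1.2,
   w.1.2 + const_mx c, w.2).

Definition orbit_of w : set (config R n N k) := [set R_action c w | c in setT].

Definition critical_orbits (f : config R n N k -> R) :
    set (set (config R n N k)) :=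
  orbit_of @` [set w | critical_point f w].

End ChainFunction.

(* Main.v *)
Require Import Defs.
From HB Require Import structures.
From mathcomp Require Import all_boot all_order all_algebra.
From mathcomp Require Import all_classical all_reals all_analysis.
From mathcomp Require Import ring lra.
Set Implicit Arguments.
Unset Strict Implicit.
Unset Printing Implicit Defensive.
Import Order.TTheory GRing.Theory Num.Theory.
Import numFieldNormedType.Exports.
Local Open Scope classical_set_scope.
Local Open Scope ring_scope.

(** Write P = k * A / S, where S is the sum of the exp(r_j) and A is the sum in
the definition of P, and let L = A / S.  For each j let z_j be the point at
which F is evaluated (its base point q_j together with zeta_j), let
(X_j, Y_j, Z_j) be the base derivative of F at z_j, and put a_j = exp(-r_j/2).
Since dP = (k / S) (dA - L dS), the critical equations are those of A with L
as a Lagrange multiplier for S, namely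
- in zeta_j: z_j lies on the fibre-critical set of F;
- in x_j: u_j + u_(j-1) = 0 for u_j = X_j / a_j + y_(j+1) - y_j, and similarly
  in y_j.  On a cycle of odd length this alternation forces u = 0, so that
  X_j = a_j (y_j - y_(j+1)) and Y_j = a_j (x_(j+1) - x_j);
- in theta_(j+1): Z_j + 1 = exp(r_(j-1) - r_j);
- in r_j: F(z_j) - (q_j^x X_j + q_j^y Y_j) / 2 + theta_(j+1) - theta_(j+2) = L.
These decoupled equations are called [link] below, and [critical_linkP] is this
equivalence.

Now set p_j = (exp(-r_(j-1)/2) x_j, exp(-r_(j-1)/2) y_j, theta_(j+1)).  The
half-sum and the difference of exp(g/2) x and phi_x that occur in Gamma
determine both vectors, so comparing i_F(z_j) with Gamma shows that the link
equations say exactly that i_F(z_j) = Gamma(p_j), that g(p_j) = r_(j-1) - r_j,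
and that p_(j+1) is phi(p_j) moved by the Reeb flow for time -L
([link_realizes], [realizes_link]).  In particular the g(p_j) telescope to 0
and p is a translated chain of action L k = P.

Conversely a chain determines the r_j up to a common constant, because the
g(p_j) sum to 0 ([cyclic_potential]); it then determines x, y and theta, and it
determines zeta because i_F is injective on the fibre-critical set
([translated_chain_realized], [chain_point_inj]).  The free constant is exactly
the R-action.  Finally the link equations with any t in place of L imply t = L,
because summing exp(r_j) times the last one gives A = t S ([link_level]); this
is why a reconstructed configuration is critical, with the right value. *)

(** * Differentials of the building blocks *)

Section DiffCalculus.
Context {R : realType}.
Implicit Types U V W : normedModType R.

Lemma is_diff_linear V W (f : {linear V -> W}) (x : V) :
  continuous f -> is_diff x f f.
Proof.
by move=> fc; apply: DiffDef; [exact: linear_differentiable|exact: diff_lin].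
Qed.

Lemma is_diff_fst V W U (f df : U -> V * W) x :
  is_diff x f df -> is_diff x (fun y => (f y).1) (fun y => (df y).1).
Proof.
move=> fx; apply: (is_diff_comp fx).
by apply: (@is_diff_linear _ _ fst) => y; exact: cvg_fst.
Qed.

Lemma is_diff_snd V W U (f df : U -> V * W) x :
  is_diff x f df -> is_diff x (fun y => (f y).2) (fun y => (df y).2).
Proof.
move=> fx; apply: (is_diff_comp fx).
by apply: (@is_diff_linear _ _ snd) => y; exact: cvg_snd.
Qed.

(** The norm is the largest entry, so extracting a row is 1-Lipschitz. *)
Lemma continuous_row k n (j : 'I_k) : continuous (@row R k n j).
Proof.
apply: bounded_linear_continuous; apply/linear_boundedP.
exists 1; split=> // r r1 A.
apply: (@le_trans _ _ `|A|); last by rewrite ler_peMl// ltW.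
rewrite /Num.norm/= !mx_normrE; apply: bigmax_le => [|i _].
  exact: bigmax_ge_id.
pose entry_norm (ij : 'I_k * 'I_n) := `|A ij.1 ij.2|.
by rewrite mxE; exact: (le_bigmax _ entry_norm (j, i.2)).
Qed.

Lemma is_diff_row U k n (j : 'I_k) (f df : U -> 'M[R]_(k, n)) x :
  is_diff x f df -> is_diff x (fun y => row j (f y)) (fun y => row j (df y)).
Proof.
move=> fx; apply: (is_diff_comp fx).
by apply: (@is_diff_linear _ _ (row j)); exact: continuous_row.
Qed.

Lemma is_diff_entry U k n i j (f df : U -> 'M[R]_(k, n)) x :
  is_diff x f df -> is_diff x (fun y => f y i j) (fun y => df y i j).
Proof.
move=> fx.
have lin : linear (fun A : 'M[R]_(k, n) => A i j : R).
  by move=> c A B; rewrite !mxE.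
pose l : {linear 'M[R]_(k, n) -> R} :=
  HB.pack (fun A : 'M[R]_(k, n) => A i j : R)
    (GRing.isLinear.Build _ _ _ _ _ lin).
have lx : is_diff (f x) l l.
  by apply: is_diff_linear; exact: (@coord_continuous R k n i j).
exact: (is_diff_comp fx lx).
Qed.

Lemma is_diff_sum U V (I : finType) (f df : I -> U -> V) x :
  (forall i, is_diff x (f i) (df i)) ->
  is_diff x (fun y => \sum_i f i y) (fun y => \sum_i df i y).
Proof.
move=> fx; have sumE (h : I -> U -> V) : (fun y => \sum_i h i y) = \sum_i h i.
  by apply/funext => y; rewrite fct_sumE.
rewrite !sumE; elim/big_ind2 : _ => // [|? ? ? ? ? ?].
  exact: is_diff_cst.
exact: is_diffD.
Qed.

Lemma is_diff_add U V (f g df dg : U -> V) x :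
  is_diff x f df -> is_diff x g dg ->
  is_diff x (fun y => f y + g y) (fun v => df v + dg v).
Proof. exact: is_diffD. Qed.

Lemma is_diff_sub U V (f g df dg : U -> V) x :
  is_diff x f df -> is_diff x g dg ->
  is_diff x (fun y => f y - g y) (fun v => df v - dg v).
Proof. exact: is_diffB. Qed.

Lemma is_diff_opp U V (f df : U -> V) x :
  is_diff x f df -> is_diff x (fun y => - f y) (fun v => - df v).
Proof. exact: is_diffN. Qed.

Lemma is_diff_scalec U V (c : R) (f df : U -> V) x :
  is_diff x f df -> is_diff x (fun y => c *: f y) (fun v => c *: df v).
Proof. exact: is_diffZ. Qed.

Lemma is_diff_mul U (f g df dg : U -> R) x :
  is_diff x f df -> is_diff x g dg ->
  is_diff x (fun y => f y * g y) (fun v => f x * dg v + df v * g x).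
Proof.
move=> fx gx; apply: (@is_diff_eq _ _ _ _ _ _ _ (is_diffM fx gx)).
by apply/funext => v /=; rewrite [df v * _]mulrC.
Qed.

Lemma is_diff_exp U (f df : U -> R) x :
  is_diff x f df ->
  is_diff x (fun y => expR (f y)) (fun v => df v * expR (f x)).
Proof.
have dexp : differentiable (@expR R) (f x).
  by apply/derivable1_diffP; exact: derivable_expR.
have expx : is_diff (f x) (@expR R) (fun h => h * expR (f x)).
  apply: DiffDef => //; rewrite diff1E// derive1E.
  by rewrite (@derive_val _ _ _ _ _ _ _ (is_derive_expR (f x))).
by move=> fx; exact: (is_diff_comp fx expx).
Qed.

(** Scaling is a continuous bilinear map, so this is the Leibniz rule for it. *)
Lemma is_diff_scale U V (c dc : U -> R) (f df : U -> V) x :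
  is_diff x c dc -> is_diff x f df ->
  is_diff x (fun y => c y *: f y) (fun v => c x *: df v + dc v *: f x).
Proof.
move=> cx fx.
have bil : bilinear_for (GRing.Scale.Law.clone _ _ *:%R _)
    (GRing.Scale.Law.clone _ _ *:%R _) (fun (a : R) (u : V) => a *: u).
  split=> [u|u] a p q /=; first by rewrite scalerDl scalerA.
  by rewrite scalerDr !scalerA [u * a]mulrC.
pose s : {bilinear R -> V -> V} := HB.pack (fun (a : R) (u : V) => a *: u)
  (bilinear_isBilinear.Build R R V V _ _ _ bil).
have sc : continuous (fun p : R * V => s p.1 p.2).
  by move=> p; exact: scale_continuous.
have sx : is_diff (c x, f x) (fun p : R * V => s p.1 p.2)
    (fun q : R * V => c x *: q.2 + q.1 *: f x).
  by apply: DiffDef; [exact: differentiable_bilin|exact: diff_bilin].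
exact: (is_diff_comp (is_diff_pair cx fx) sx).
Qed.

Lemma is_diff_inv U (f df : U -> R) x : f x != 0 ->
  is_diff x f df ->
  is_diff x (fun y => (f y)^-1) (fun v => - (f x) ^- 2 * df v).
Proof.
move=> fx0 fx; apply: DiffDef.
  by apply: differentiableV => //; apply: ex_diff.
by rewrite diffV// ?diff_val//; apply: ex_diff.
Qed.

Lemma is_diff_dot U n (f g df dg : U -> 'rV[R]_n) x :
  is_diff x f df -> is_diff x g dg ->
  is_diff x (fun y => dot (f y) (g y))
            (fun v => dot (f x) (dg v) + dot (df v) (g x)).
Proof.
move=> fx gx.
have fgx i := is_diff_mul (is_diff_entry ord0 i fx) (is_diff_entry ord0 i gx).
apply: (@is_diff_eq _ _ _ _ _ _ _ (is_diff_sum fgx)).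
by apply/funext => v; rewrite big_split.
Qed.

End DiffCalculus.

(** * Scalar products *)

Section Dot.
Context {R : realType} {n : nat}.
Implicit Types u v w : 'rV[R]_n.

Lemma dotC u v : dot u v = dot v u.
Proof. by apply: eq_bigr => i _; rewrite mulrC. Qed.

Lemma dotDr u v w : dot u (v + w) = dot u v + dot u w.
Proof. by rewrite -big_split; apply: eq_bigr => i _; rewrite mxE mulrDr. Qed.

Lemma dotZr c u v : dot u (c *: v) = c * dot u v.
Proof.
by rewrite /dot mulr_sumr; apply: eq_bigr => i _; rewrite mxE mulrCA.
Qed.

Lemma dotNr u v : dot u (- v) = - dot u v.
Proof. by rewrite -scaleN1r dotZr mulN1r. Qed.

Lemma dotDl u v w : dot (v + w) u = dot v u + dot w u.
Proof. by rewrite dotC dotDr !(dotC u). Qed.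

Lemma dotZl c u v : dot (c *: v) u = c * dot v u.
Proof. by rewrite dotC dotZr dotC. Qed.

Lemma dotNl u v : dot (- v) u = - dot v u.
Proof. by rewrite dotC dotNr dotC. Qed.

Lemma dot0l u : dot 0 u = 0.
Proof. by rewrite -(scale0r 0) dotZl mul0r. Qed.

Definition dotE := (dotDl, dotDr, dotNl, dotNr, dotZl, dotZr).

Lemma dot_ge0 u : 0 <= dot u u.
Proof. by apply: sumr_ge0 => i _; rewrite -expr2 sqr_ge0. Qed.

Lemma dot_eq0 u : dot u u = 0 -> u = 0.
Proof.
move=> /eqP; rewrite psumr_eq0 => [|i _]; last by rewrite -expr2 sqr_ge0.
move=> /allP u0; apply/rowP => i; rewrite mxE.
by have := u0 i (mem_index_enum i); rewrite mulf_eq0 orbb => /eqP.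
Qed.

(** The row of values of a linear form on the canonical basis represents the
form; the base and fibre derivatives of F are rows of this kind. *)
Lemma dot_row_linear (f : 'rV[R]_n -> R) u :
  linear f -> dot (\row_i f (delta_mx ord0 i)) u = f u.
Proof.
move=> lin; pose l : {linear 'rV[R]_n -> R} :=
  HB.pack f (GRing.isLinear.Build _ _ _ _ _ lin).
rewrite -[f]/(l : _ -> _) [in RHS](row_sum_delta u) linear_sum.
by apply: eq_bigr => i _; rewrite linearZ mxE mulrC.
Qed.

End Dot.

Lemma scale_add_pair (R : realType) (U V : lmodType R) (a : R) (u u' : U)
  (v v' : V) : a *: (u, v) + (u', v') = (a *: u + u', a *: v + v').
Proof. by []. Qed.

Lemma diff_base_fibre (R : realType) n N (F : pt R n * 'rV[R]_N -> R) z v :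
  'd F z v = dot (xcoord (base_derivative F z)) (xcoord v.1)
           + dot (ycoord (base_derivative F z)) (ycoord v.1)
           + tcoord (base_derivative F z) * tcoord v.1
           + dot (fibre_derivative F z) v.2.
Proof.
case: v => [[[x y] t] s]; rewrite /base_derivative /fibre_derivative.
rewrite /xcoord /ycoord /tcoord /=.
rewrite (dot_row_linear (f := fun u => 'd F z (u, 0, 0, 0))); last first.
  by move=> a p q; rewrite -linearP !scale_add_pair !scaler0 !addr0.
rewrite (dot_row_linear (f := fun u => 'd F z (0, u, 0, 0))); last first.
  by move=> a p q; rewrite -linearP !scale_add_pair !scaler0 !addr0.
rewrite (dot_row_linear (f := fun u => 'd F z (0, u))); last first.
  by move=> a p q; rewrite -linearP !scale_add_pair !scaler0 !addr0.
rewrite [X in _ + _ + X + _](_ : _ = 'd F z (t *: (0, 0, 1, 0))); last first.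
  by rewrite linearZ; exact: mulrC.
rewrite -!linearD; congr ('d F z _).
have addE (U V : zmodType) (u u' : U) (v v' : V) :
  (u, v) + (u', v') = (u + u', v + v') by [].
have scE (U V : lmodType R) (a : R) (u : U) (v : V) :
  a *: (u, v) = (a *: u, a *: v) by [].
by rewrite !scE !addE !scaler0 !addr0 !add0r [t *: _]mulr1.
Qed.

(** * Functions on a cycle *)

Section CyclicOrdinals.
Context {k : nat}.

Lemma val_iter_ordS m (j : 'I_k) : iter m (@ordS k) j = ((j + m) %% k)%N :> nat.
Proof.
elim: m => [|m IH]; first by rewrite addn0 modn_small.
by rewrite iterS /= IH -addn1 modnDml addn1 addnS.
Qed.

Lemma cyclic_const (T : Type) (f : 'I_k -> T) i j :
  (forall l, f (ordS l) = f l) -> f i = f j.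
Proof.
move=> fS; have fI m l : f (iter m (@ordS k) l) = f l.
  by elim: m => //= m IH; rewrite fS.
rewrite -(fI (j + (k - i))%N i); congr f; apply: val_inj => /=.
rewrite val_iter_ordS addnCA subnKC; last exact: ltnW.
by rewrite modnDr modn_small.
Qed.

(** Going once around the cycle changes the sign k times, so u j = - u j when k
is odd. *)
Lemma odd_cyclic_eq0 (R : realType) (V : lmodType R) (u : 'I_k -> V) :
  odd k -> (forall j, u (ordS j) = - u j) -> forall j, u j = 0.
Proof.
move=> hk uS j; have uI m : u (iter m (@ordS k) j) = (-1) ^+ m *: u j.
  by elim: m => [|m IH]; rewrite ?scale1r// iterS uS IH exprS mulN1r scaleNr.
have jk : iter k (@ordS k) j = j.
  by apply: val_inj; rewrite /= val_iter_ordS modnDr modn_small.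
have := uI k; rewrite jk -signr_odd hk expr1 scaleN1r.
move=> /eqP; rewrite -subr_eq0 opprK -mulr2n -scaler_nat scaler_eq0.
by rewrite pnatr_eq0 => /eqP.
Qed.

Lemma sum_ordS (V : zmodType) (f : 'I_k -> V) : \sum_j f (ordS j) = \sum_j f j.
Proof. by rewrite [RHS](reindex_inj (@ordS_inj k)). Qed.

(** Minus the partial sums of f is such a potential: the condition at the wrap
from the last index to 0 is the vanishing of the total sum. *)
Lemma cyclic_potential (V : zmodType) (f : 'I_k -> V) :
  \sum_j f j = 0 -> exists r : 'I_k -> V, forall j, r (ord_pred j) - r j = f j.
Proof.
move=> f0; exists (fun j => - \sum_(i < k | (i <= j)%N) f i) => j.
have k0 : (0 < k)%N := leq_ltn_trans (leq0n j) (ltn_ord j).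
rewrite opprK addrC; case: (posnP j) => [j0|jgt0].
  have -> : \sum_(i < k | (i <= ord_pred j)%N) f i = 0.
    rewrite -[RHS]f0; apply: eq_bigl => i /=.
    by rewrite j0 add0n modn_small ?prednK// -ltnS prednK// ltn_ord.
  rewrite oppr0 addr0 (bigD1 j)//= big1 ?addr0// => i /andP[].
  by rewrite j0 leqn0 => /eqP i0; case/eqP; apply: val_inj; rewrite /= i0 j0.
have pj : ord_pred j = j.-1 :> nat.
  rewrite /= -[in LHS](prednK jgt0) addSn /= modnDr modn_small//.
  by rewrite prednK// ltnW.
rewrite (bigD1 j)//= -addrA (eq_bigl (fun i : 'I_k => i <= ord_pred j)%N).
  by rewrite subrr addr0.
move=> i; rewrite pj -[RHS]ltnS prednK// ltn_neqAle andbC.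
by rewrite -(inj_eq val_inj).
Qed.

End CyclicOrdinals.

(** * Configurations *)

Section ConfigInner.
Context {R : realType} {n N k : nat}.
Implicit Types (u v w : config R n N k) (j : 'I_k).

Definition config_of_rows (x y : 'I_k -> 'rV[R]_n) (t r : 'I_k -> R)
    (z : 'I_k -> 'rV[R]_N) : config R n N k :=
  (\matrix_j x j, \matrix_j y j, \col_j t j, \col_j r j, \matrix_j z j).

Lemma cx_rows x y t r z j : cx (config_of_rows x y t r z) j = x j.
Proof. exact: rowK. Qed.

Lemma cy_rows x y t r z j : cy (config_of_rows x y t r z) j = y j.
Proof. exact: rowK. Qed.

Lemma ctheta_rows x y t r z j : ctheta (config_of_rows x y t r z) j = t j.
Proof. exact: mxE. Qed.

Lemma cr_rows x y t r z j : cr (config_of_rows x y t r z) j = r j.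
Proof. exact: mxE. Qed.

Lemma czeta_rows x y t r z j : czeta (config_of_rows x y t r z) j = z j.
Proof. exact: rowK. Qed.

Definition rowsE := (cx_rows, cy_rows, ctheta_rows, cr_rows, czeta_rows).

Lemma config_eqP u v :
  (forall j, [/\ cx u j = cx v j, cy u j = cy v j, ctheta u j = ctheta v j,
                 cr u j = cr v j & czeta u j = czeta v j]) -> u = v.
Proof.
move: u v => [[[[ux uy] ut] ur] uz] [[[[vx vy] vt] vr] vz] uv.
have -> : ux = vx by apply/row_matrixP => j; case: (uv j).
have -> : uy = vy by apply/row_matrixP => j; case: (uv j).
have -> : ut = vt by apply/colP => j; case: (uv j).
have -> : ur = vr by apply/colP => j; case: (uv j).
by have -> : uz = vz by apply/row_matrixP => j; case: (uv j).
Qed.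

(** The Euclidean structure of the configuration space: a differential given as
an inner product with a vector vanishes exactly when that vector does. *)
Definition inner u v : R :=
  \sum_j (dot (cx u j) (cx v j) + dot (cy u j) (cy v j)
          + ctheta u j * ctheta v j + cr u j * cr v j
          + dot (czeta u j) (czeta v j)).

Lemma inner_eq0 u : inner u u = 0 -> forall j,
  [/\ cx u j = 0, cy u j = 0, ctheta u j = 0, cr u j = 0 & czeta u j = 0].
Proof.
move=> /eqP; rewrite psumr_eq0 => [/allP u0 j|j _]; last first.
  by rewrite !addr_ge0 ?dot_ge0// -expr2 sqr_ge0.
move: (u0 j (mem_index_enum j)).
rewrite -!expr2 !paddr_eq0 ?addr_ge0 ?dot_ge0 ?sqr_ge0//.
by rewrite !sqrf_eq0 => /andP[/andP[/andP[/andP[/eqP/dot_eq0 -> /eqP/dot_eq0 ->]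
  /eqP ->] /eqP ->] /eqP/dot_eq0 ->].
Qed.

Lemma is_diff_cx w j : is_diff w (@cx R n N k ^~ j) (@cx R n N k ^~ j).
Proof. by do ![apply: is_diff_row|apply: is_diff_fst|apply: is_diff_id]. Qed.

Lemma is_diff_cy w j : is_diff w (@cy R n N k ^~ j) (@cy R n N k ^~ j).
Proof.
by apply: is_diff_row; apply: is_diff_snd; do !apply: is_diff_fst.
Qed.

Lemma is_diff_ctheta w j :
  is_diff w (@ctheta R n N k ^~ j) (@ctheta R n N k ^~ j).
Proof.
by apply: is_diff_entry; apply: is_diff_snd; do !apply: is_diff_fst.
Qed.

Lemma is_diff_cr w j : is_diff w (@cr R n N k ^~ j) (@cr R n N k ^~ j).
Proof.
by apply: is_diff_entry; apply: is_diff_snd; do !apply: is_diff_fst.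
Qed.

Lemma is_diff_czeta w j : is_diff w (@czeta R n N k ^~ j) (@czeta R n N k ^~ j).
Proof. by apply: is_diff_row; apply: is_diff_snd; exact: is_diff_id. Qed.

End ConfigInner.

Lemma expR_half (R : realType) (r : R) : expR r = expR (r / 2) ^+ 2.
Proof. by rewrite -expRM_natr divfK// pnatr_eq0. Qed.

(** * The gradient of the chain function *)

Section Gradient.
Context {R : realType} {n N k : nat} (F : pt R n * 'rV[R]_N -> R).
Implicit Types (u v w : config R n N k) (j : 'I_k).

Definition sample w j : pt R n * 'rV[R]_N :=
  ((expR (- (cr w j / 2)) *: (2^-1 *: (cx w j + cx w (ordS j))),
    expR (- (cr w j / 2)) *: (2^-1 *: (cy w j + cy w (ordS j))),
    ctheta w (ordS j)),
   czeta w j).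

Definition summand w j : R :=
  expR (cr w j) * F (sample w j)
  + 2^-1 * (dot (cx w j) (cy w (ordS j)) - dot (cx w (ordS j)) (cy w j))
  + expR (cr w (ord_pred j)) * (ctheta w j - ctheta w (ordS j)).

Definition weight w : R := \sum_j expR (cr w j).

(** The chain function is k times the level; at a critical point the level is
the time t of the translated chain. *)
Definition level w : R := (\sum_j summand w j) / weight w.

Definition slope w j := base_derivative F (sample w j).

Lemma P_FE w : P_F F w = k%:R * level w.
Proof. by rewrite /level [_ / _]mulrC mulrA. Qed.

(** The following five families are the components of the gradient of the level
multiplied by the weight, that is of grad A - L grad S for the level L = A / S.
Each row x_j or y_j occurs in the samples j and j-1, with the factor
exp(r) exp(-r/2) / 2 of the respective index. *)
Definition grad_x w j : 'rV[R]_n :=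
  2^-1 *: (expR (cr w j / 2) *: xcoord (slope w j)
           + expR (cr w (ord_pred j) / 2) *: xcoord (slope w (ord_pred j))
           + (cy w (ordS j) - cy w (ord_pred j))).

Definition grad_y w j : 'rV[R]_n :=
  2^-1 *: (expR (cr w j / 2) *: ycoord (slope w j)
           + expR (cr w (ord_pred j) / 2) *: ycoord (slope w (ord_pred j))
           + (cx w (ord_pred j) - cx w (ordS j))).

Definition grad_theta w j : R :=
  expR (cr w (ord_pred j)) * (tcoord (slope w (ord_pred j)) + 1)
  - expR (cr w (ord_pred (ord_pred j))).

Definition grad_r w j : R :=
  expR (cr w j) * (F (sample w j)
    - 2^-1 * (dot (xcoord (slope w j)) (xcoord (sample w j).1)
              + dot (ycoord (slope w j)) (ycoord (sample w j).1))
    + ctheta w (ordS j) - ctheta w (ordS (ordS j)) - level w).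

Definition grad_zeta w j : 'rV[R]_N :=
  expR (cr w j) *: fibre_derivative F (sample w j).

Definition gradient w : config R n N k :=
  config_of_rows (grad_x w) (grad_y w) (grad_theta w) (grad_r w) (grad_zeta w).

(** This and [dsummand] are left in the shape that the chain and Leibniz rules
produce, so that these rules apply verbatim. *)
Definition dsample w v j : pt R n * 'rV[R]_N :=
  let half_scale (x dx : 'rV[R]_n) := expR (- (cr w j / 2)) *: (2^-1 *: dx)
      + (- (cr v j / 2) * expR (- (cr w j / 2))) *: (2^-1 *: x) in
  ((half_scale (cx w j + cx w (ordS j)) (cx v j + cx v (ordS j)),
    half_scale (cy w j + cy w (ordS j)) (cy v j + cy v (ordS j)),
    ctheta v (ordS j)),
   czeta v j).

Lemma is_diff_sample w j : is_diff w (sample ^~ j) (fun v => dsample w v j).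
Proof.
have fm (f : config R n N k -> 'I_k -> 'rV[R]_n) :
    (forall i, is_diff w (f ^~ i) (f ^~ i)) ->
    is_diff w
     (fun u => expR (- (cr u j / 2)) *: (2^-1 *: (f u j + f u (ordS j))))
     (fun v => expR (- (cr w j / 2)) *: (2^-1 *: (f v j + f v (ordS j)))
      + (- (cr v j / 2) * expR (- (cr w j / 2))) *:
          (2^-1 *: (f w j + f w (ordS j)))).
  move=> fx; apply: is_diff_scale.
    apply: is_diff_exp; apply: is_diff_opp.
    rewrite (_ : (fun u => _) = fun u => 2^-1 *: cr u j); last first.
      by apply/funext => u; rewrite mulrC.
    by apply: is_diff_scalec; exact: is_diff_cr.
apply: is_diff_pair; last exact: is_diff_czeta.
apply: is_diff_pair; last exact: is_diff_ctheta.
by apply: is_diff_pair; [exact: fm (is_diff_cx w)|exact: fm (is_diff_cy w)].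
Qed.

Definition dsummand w v j : R :=
  (expR (cr w j) * 'd F (sample w j) (dsample w v j)
   + (cr v j * expR (cr w j)) * F (sample w j))
  + 2^-1 * ((dot (cx w j) (cy v (ordS j)) + dot (cx v j) (cy w (ordS j)))
            - (dot (cx w (ordS j)) (cy v j) + dot (cx v (ordS j)) (cy w j)))
  + (expR (cr w (ord_pred j)) * (ctheta v j - ctheta v (ordS j))
     + (cr v (ord_pred j) * expR (cr w (ord_pred j)))
         * (ctheta w j - ctheta w (ordS j))).

Context (dF : forall z, differentiable F z).

Lemma is_diff_summand w j : is_diff w (summand ^~ j) (fun v => dsummand w v j).
Proof.
have cxw := is_diff_cx w; have cyw := is_diff_cy w.
have crw := is_diff_cr w; have ctw := is_diff_ctheta w.
apply: is_diff_add.
  apply: is_diff_add.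
    apply: is_diff_mul; first exact: is_diff_exp.
    have Fz : is_diff (sample w j) F ('d F (sample w j)).
      by apply: DiffDef => //; exact: dF.
    exact: (is_diff_comp (is_diff_sample w j) Fz).
  by apply: is_diff_scalec; apply: is_diff_sub; exact: is_diff_dot.
by apply: is_diff_mul; exact: is_diff_exp.
Qed.

Lemma weight_gt0 w : (0 < k)%N -> 0 < weight w.
Proof.
move=> k0; rewrite /weight (bigD1 (Ordinal k0))//= ltr_pwDl ?expR_gt0//.
by apply: sumr_ge0 => j _; exact: expR_ge0.
Qed.

(** In the differential of the j-th summand the variations with index j+1, and
the variation of r_(j-1), sit at the wrong index; transfer at j+1 minus transfer
at j moves them to their own index, and sums to 0 over the cycle. *)
Definition transfer w v i : R :=
  2^-1 * (expR (cr w (ord_pred i) / 2)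
               * (dot (xcoord (slope w (ord_pred i))) (cx v i)
                  + dot (ycoord (slope w (ord_pred i))) (cy v i))
      + dot (cx w (ord_pred i)) (cy v i) - dot (cy w (ord_pred i)) (cx v i))
      + (expR (cr w (ord_pred i)) * tcoord (slope w (ord_pred i))
         - expR (cr w (ord_pred (ord_pred i)))) * ctheta v i
      - cr v (ord_pred i) * expR (cr w (ord_pred i))
         * (ctheta w i - ctheta w (ordS i)).

Lemma summand_differential w v j :
  dsummand w v j - level w * (cr v j * expR (cr w j))
  = dot (grad_x w j) (cx v j) + dot (grad_y w j) (cy v j)
    + grad_theta w j * ctheta v j + grad_r w j * cr v j
    + dot (grad_zeta w j) (czeta v j)
    + (transfer w v (ordS j) - transfer w v j).
Proof.
rewrite /transfer ordSK /dsummand diff_base_fibre -/(slope _ _).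
rewrite /grad_x /grad_y /grad_theta /grad_r /grad_zeta.
set X := slope w j; set Y := slope w (ord_pred j); set z := sample w j.
rewrite [xcoord (dsample _ _ _).1]/= [ycoord (dsample _ _ _).1]/=.
rewrite [tcoord (dsample _ _ _).1]/= [(dsample _ _ _).2]/=.
rewrite [xcoord z.1]/= [ycoord z.1]/= {}/z.
clearbody X Y.
have xE (a b : 'rV[R]_n) (c : R) : xcoord (a, b, c) = a by [].
have yE (a b : 'rV[R]_n) (c : R) : ycoord (a, b, c) = b by [].
rewrite !xE !yE !dotE !(dotC (cx v _)) expRN (expR_half (cr w j)).
have := expR_gt0 (cr w j / 2); move: (expR (cr w j / 2)) => E /lt0r_neq0 E0.
by field.
Qed.

(** Quotient rule: d(A / S) = (dA - (A / S) dS) / S. *)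
Lemma is_diff_level w : (0 < k)%N ->
  is_diff w level (fun v => (weight w)^-1 * inner (gradient w) v).
Proof.
move=> k0; have w0 : weight w != 0 by rewrite gt_eqF// weight_gt0.
have dW : is_diff w weight (fun v => \sum_j cr v j * expR (cr w j)).
  by apply: is_diff_sum => j; apply: is_diff_exp; exact: is_diff_cr.
have dA : is_diff w (fun u => \sum_j summand u j)
    (fun v => \sum_j dsummand w v j).
  by apply: is_diff_sum => j; exact: is_diff_summand.
apply: (is_diff_eq (is_diff_mul dA (is_diff_inv w0 dW))).
apply/funext => v.
transitivity ((weight w)^-1 *
    \sum_j (dsummand w v j - level w * (cr v j * expR (cr w j)))).
  rewrite sumrB -mulr_sumr /level.
  by field.
congr (_ * _).
under eq_bigr do rewrite summand_differential.
rewrite big_split/= sumrB (sum_ordS (transfer w v)) subrr addr0.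
by apply: eq_bigr => j _; rewrite !rowsE.
Qed.

(** Applying the differential to the gradient itself gives a positive multiple
of its squared norm. *)
Lemma critical_pointP w : (0 < k)%N ->
  critical_point (P_F F) w <-> forall j,
  [/\ grad_x w j = 0, grad_y w j = 0, grad_theta w j = 0,
      grad_r w j = 0 & grad_zeta w j = 0].
Proof.
move=> k0.
have PE : P_F F = (fun u => k%:R *: level u) by apply/funext => u; exact: P_FE.
have dP := is_diff_scalec k%:R (is_diff_level w k0).
have kW : k%:R / weight w != 0.
  by rewrite mulf_neq0 ?pnatr_eq0 -?lt0n// invr_eq0 gt_eqF// weight_gt0.
rewrite PE /critical_point; split=> [[_ d0]|g0].
  have := d0 (gradient w); rewrite diff_val => /eqP.
  rewrite -[_ *: _]/(_ * _) mulrA mulf_eq0 (negbTE kW)/= => /eqP/inner_eq0 + j.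
  by move=> /(_ j); rewrite !rowsE.
split; first exact: ex_diff.
move=> v; rewrite diff_val -[_ *: _]/(_ * _) /inner big1 ?mulr0// => j _.
rewrite !rowsE; have [-> -> -> -> ->] := g0 j.
by rewrite !mul0r !dot0l !addr0.
Qed.

End Gradient.

(** * Decoupling the critical equations *)

Section Links.
Context {R : realType} {n N k : nat} (F : pt R n * 'rV[R]_N -> R).
Implicit Types (u v w : config R n N k) (j : 'I_k).

(** The critical equations at index j once the alternating ones have been
solved, with the level replaced by a free parameter t. *)
Definition link w (t : R) j : Prop :=
  [/\ xcoord (slope F w j) = expR (- (cr w j / 2)) *: (cy w j - cy w (ordS j)),
      ycoord (slope F w j) = expR (- (cr w j / 2)) *: (cx w (ordS j) - cx w j),
      tcoord (slope F w j) + 1 = expR (cr w (ord_pred j) - cr w j),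
      F (sample w j)
        - 2^-1 * (dot (xcoord (slope F w j)) (xcoord (sample w j).1)
          + dot (ycoord (slope F w j)) (ycoord (sample w j).1))
        + ctheta w (ordS j) - ctheta w (ordS (ordS j)) = t
    & fibre_derivative F (sample w j) = 0].

(** The half-sum of two consecutive points is paired with their difference
rotated by a quarter turn, so only the area that they span survives. *)
Lemma slope_area w j (a := expR (- (cr w j / 2))) :
  xcoord (slope F w j) = a *: (cy w j - cy w (ordS j)) ->
  ycoord (slope F w j) = a *: (cx w (ordS j) - cx w j) ->
  dot (xcoord (slope F w j)) (xcoord (sample w j).1)
    + dot (ycoord (slope F w j)) (ycoord (sample w j).1)
  = a ^+ 2 * (dot (cy w j) (cx w (ordS j)) - dot (cx w j) (cy w (ordS j))).
Proof.
move=> -> ->; rewrite [xcoord _]/= [ycoord _]/= -/a !dotE.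
by rewrite !(dotC (cx w _) (cy w _)); field.
Qed.

(** By [slope_area] the quadratic term of a summand cancels against the one in
the link equation, which leaves t exp(r_j) up to a telescoping term. *)
Lemma link_level w t : (0 < k)%N -> (forall j, link w t j) -> level F w = t.
Proof.
move=> k0 lw; have w0 : weight w != 0 by rewrite gt_eqF// weight_gt0.
apply: (mulIf w0); rewrite /level divfK//.
pose H j := expR (cr w (ord_pred j)) * (ctheta w j - ctheta w (ordS j)).
transitivity (\sum_j (t * expR (cr w j) - (H (ordS j) - H j))).
  apply: eq_bigr => j _; have [sx sy _ Ft _] := lw j; have := slope_area sx sy.
  move: Ft; rewrite /H ordSK /summand => /[swap] -> Ft.
  have e0 := lt0r_neq0 (expR_gt0 (cr w j)).
  have -> : F (sample w j) = t + 2^-1 * (expR (- (cr w j / 2)) ^+ 2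
    * (dot (cy w j) (cx w (ordS j)) - dot (cx w j) (cy w (ordS j))))
    - ctheta w (ordS j) + ctheta w (ordS (ordS j)) by rewrite -Ft; ring.
  rewrite (dotC (cx w (ordS j))) expRN exprVn -expR_half.
  by field.
by rewrite sumrB -mulr_sumr sumrB (sum_ordS H) subrr subr0.
Qed.

(** The x- and y-equations only give the sum of two consecutive defects ux (or
uy); odd length makes each defect vanish. *)
Lemma critical_linkP w : odd k -> (forall z, differentiable F z) ->
  critical_point (P_F F) w <-> forall j, link w (level F w) j.
Proof.
move=> hk dF; have k0 : (0 < k)%N by case: (k) hk.
rewrite critical_pointP//; have E0 j := lt0r_neq0 (expR_gt0 (cr w j)).
have H0 j := lt0r_neq0 (expR_gt0 (cr w j / 2)).
have half0 (V : lmodType R) (u : V) : 2^-1 *: u = 0 -> u = 0.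
  by move=> /eqP; rewrite scaler_eq0 invr_eq0 pnatr_eq0/= => /eqP.
split=> [gw j|lw j].
  pose ux i := expR (cr w i / 2) *: xcoord (slope F w i)
              + (cy w (ordS i) - cy w i).
  pose uy i := expR (cr w i / 2) *: ycoord (slope F w i)
              + (cx w i - cx w (ordS i)).
  have xe : forall i, ux i = 0.
    apply: odd_cyclic_eq0 => // i; apply/eqP; rewrite -addr_eq0; apply/eqP.
    have [+ _ _ _ _] := gw (ordS i); rewrite /grad_x ordSK => /half0 <-.
    by rewrite addrACA subrKA.
  have ye : forall i, uy i = 0.
    apply: odd_cyclic_eq0 => // i; apply/eqP; rewrite -addr_eq0; apply/eqP.
    have [_ + _ _ _] := gw (ordS i); rewrite /grad_y ordSK => /half0 <-.
    by rewrite addrACA [cx w (ordS i) - _ + _]addrC subrKA.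
  have [_ _ _ + +] := gw j; have [_ _ + _ _] := gw (ordS j).
  rewrite /grad_theta ordSK /grad_r /grad_zeta.
  move=> /eqP; rewrite subr_eq0 => /eqP te.
  move=> /eqP; rewrite mulf_eq0 (negbTE (E0 j))/= subr_eq0 => /eqP re.
  move=> /eqP; rewrite scaler_eq0 (negbTE (E0 j))/= => /eqP ze.
  split=> //.
  - move: (xe j) => /eqP; rewrite addr_eq0 opprB => /eqP <-.
    by rewrite expRN scalerK.
  - move: (ye j) => /eqP; rewrite addr_eq0 opprB => /eqP <-.
    by rewrite expRN scalerK.
  - by rewrite expRB -te mulrC mulKf.
have [xj yj tj rj zj] := lw j; have [xp yp tp _ _] := lw (ord_pred j).
rewrite ord_predK in xp yp tp.
split.
- rewrite /grad_x; move: (slope F w j) (slope F w (ord_pred j)) xj xp.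
  move=> ? ? -> ->; rewrite !expRN !scalerA !divff// !scale1r.
  by rewrite addrAC !subrKA subrr scaler0.
- rewrite /grad_y; move: (slope F w j) (slope F w (ord_pred j)) yj yp.
  move=> ? ? -> ->; rewrite !expRN !scalerA !divff// !scale1r.
  by rewrite !subrKA subrr scaler0.
- by rewrite /grad_theta tp expRB mulrC divfK// subrr.
- by rewrite /grad_r rj subrr mulr0.
- by rewrite /grad_zeta zj scaler0.
Qed.

End Links.

(** * The action on configurations *)

Section Action.
Context {R : realType} {n N k : nat}.
Implicit Types (w : config R n N k) (j : 'I_k).

Lemma cx_R_action c w j : cx (R_action c w) j = expR (c / 2) *: cx w j.
Proof. exact: linearZ. Qed.

Lemma cy_R_action c w j : cy (R_action c w) j = expR (c / 2) *: cy w j.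
Proof. exact: linearZ. Qed.

Lemma ctheta_R_action c w j : ctheta (R_action c w) j = ctheta w j.
Proof. by []. Qed.

Lemma cr_R_action c w j : cr (R_action c w) j = cr w j + c.
Proof. by rewrite /cr !mxE. Qed.

Lemma czeta_R_action c w j : czeta (R_action c w) j = czeta w j.
Proof. by []. Qed.

Definition R_actionE := (cx_R_action, cy_R_action, ctheta_R_action,
                         cr_R_action, czeta_R_action).

Lemma R_action_cancel c c' w : R_action (c' - c) (R_action c w) = R_action c' w.
Proof.
apply: config_eqP => j; rewrite !R_actionE; split=> //.
- by rewrite scalerA -expRD -mulrDl subrK.
- by rewrite scalerA -expRD -mulrDl subrK.
- by rewrite -addrA subrKC.
Qed.

Lemma orbit_of_R_action c w : orbit_of (R_action c w) = orbit_of w.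
Proof.
apply/seteqP; split=> _ [c' _ <-].
  exists (c + c') => //.
  by rewrite -(R_action_cancel c (c + c')) [c + c']addrC addrK.
by exists (c' - c) => //; rewrite R_action_cancel.
Qed.

Lemma orbit_of_refl w : orbit_of w w.
Proof.
exists 0 => //; apply: config_eqP => j.
by rewrite !R_actionE mul0r expR0 !scale1r addr0.
Qed.

(** The scaling uses r_(j-1) and the height uses theta_(j+1); with these shifts
the end phi(p_j) of a link becomes the start p_(j+1) of the next one. *)
Definition chain_point w j : pt R n :=
  (expR (- (cr w (ord_pred j) / 2)) *: cx w j,
   expR (- (cr w (ord_pred j) / 2)) *: cy w j,
   ctheta w (ordS j)).

Lemma chain_point_R_action c w : chain_point (R_action c w) = chain_point w.
Proof.
apply/funext => j; rewrite /chain_point !R_actionE !scalerA -!expRD.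
by rewrite mulrDl opprD subrK.
Qed.

Lemma sample_R_action c w j : sample (R_action c w) j = sample w j.
Proof.
rewrite /sample !R_actionE -!scalerDr.
rewrite ![2^-1 *: (expR _ *: _)]scalerA ![2^-1 * expR _]mulrC -!scalerA.
rewrite ![expR _ *: (expR _ *: _)]scalerA -!expRD.
by rewrite mulrDl opprD subrK.
Qed.

(** The sample points are fixed, and numerator and weight both scale by
exp(c). *)
Lemma P_F_R_action (F : pt R n * 'rV[R]_N -> R) c w :
  P_F F (R_action c w) = P_F F w.
Proof.
rewrite !P_FE /level; congr (_ * _).
have -> : weight (R_action c w) = expR c * weight w.
  rewrite /weight mulr_sumr; apply: eq_bigr => j _.
  by rewrite R_actionE expRD mulrC.
have -> : \sum_j summand F (R_action c w) j = expR c * \sum_j summand F w j.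
  rewrite mulr_sumr; apply: eq_bigr => j _; rewrite /summand sample_R_action.
  rewrite !R_actionE !dotE !expRD (expR_half c); ring.
by rewrite -mulf_div divff ?mul1r// gt_eqF// expR_gt0.
Qed.

End Action.

(** * Critical configurations and translated chains *)

Section Chains.
Context {R : realType} {n N k : nat} (F : pt R n * 'rV[R]_N -> R)
  (phi : pt R n -> pt R n) (g : pt R n -> R).
Implicit Types (u v w : config R n N k) (j : 'I_k).

Lemma half_sum_diff (u v p q : 'rV[R]_n) (a : R) :
  2^-1 *: (u + v) = a *: (2^-1 *: (p + q)) -> v - u = a *: (q - p) ->
  u = a *: p /\ v = a *: q.
Proof.
move=> uv vu; have {}uv : u + v = a *: (p + q).
  have two : (2 : R) != 0 by rewrite pnatr_eq0.
  apply: (scalerI (invr_neq0 two)).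
  by rewrite uv !scalerA mulrC.
suff ua : u = a *: p.
  by split=> //; move: uv; rewrite ua scalerDr => /addrI.
apply/rowP => i; move: uv vu => /rowP/(_ i) + /rowP/(_ i); rewrite !mxE.
lra.
Qed.

(** The geometric form of the link equations. *)
Definition realizes w (t : R) j : Prop :=
  [/\ fibre_derivative F (sample w j) = 0,
      i_F F (sample w j) = Gamma phi g (chain_point w j),
      g (chain_point w j) = cr w (ord_pred j) - cr w j
    & chain_point w (ordS j) = reeb_flow (- t) (phi (chain_point w j))].

Lemma i_F_GammaP z p : i_F F z = Gamma phi g p <->
  let e := expR (g p / 2) in
  [/\ xcoord z.1 = 2^-1 *: (e *: xcoord p + xcoord (phi p)),
      ycoord z.1 = 2^-1 *: (e *: ycoord p + ycoord (phi p)) &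
      tcoord z.1 = tcoord p] /\
  [/\ xcoord (base_derivative F z) = e *: ycoord p - ycoord (phi p),
      ycoord (base_derivative F z) = xcoord (phi p) - e *: xcoord p,
      tcoord (base_derivative F z) = expR (g p) - 1 &
      F z = tcoord (phi p) - tcoord p
        + e * (dot (ycoord p) (xcoord (phi p))
               - dot (xcoord p) (ycoord (phi p))) / 2].
Proof.
rewrite /i_F /Gamma; case: (base_derivative F z) => [[a b] c].
case: z => [[[x y] t] s]; rewrite /xcoord /ycoord /tcoord /=.
by split=> [[-> -> -> -> -> -> ->]//|[[-> -> ->] [-> -> -> ->]]].
Qed.

(** The quadratic term in the last entry of Gamma is the area that occurs in
[slope_area]. *)
Lemma jet_area (e a : R) (x y x' y' p q p' q' : 'rV[R]_n) :
  e *: x = a *: p -> e *: y = a *: q -> x' = a *: p' -> y' = a *: q' ->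
  e * (dot y x' - dot x y') = a ^+ 2 * (dot q p' - dot p q').
Proof. by move=> ex ey -> ->; rewrite mulrBr -!dotZl ex ey !dotE; ring. Qed.

(** The half-sums (base point) and differences (covector) in Gamma p recover
exp(g/2) p and phi p separately; the link equations then identify them with
scalings of the j-th and (j+1)-th rows, so p is the chain point. *)
Lemma link_realizes w t j :
  i_F F @` [set z | fibre_derivative F z = 0] `<=` range (Gamma phi g) ->
  link F w t j -> realizes w t j.
Proof.
move=> FG lwj; have [sx sy st Ft fz] := lwj.
have /FG [p _ Gp] : (i_F F @` [set z | fibre_derivative F z = 0])
    (i_F F (sample w j)) by exists (sample w j).
have [] := (i_F_GammaP (sample w j) p).1 (esym Gp).
rewrite -/(slope F w j) => -[qx qy qt] [fx fy ft fv].
move: fx fy; rewrite sx sy => fx fy.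
have [ex px] := half_sum_diff (esym qx) (esym fy).
have [ey py] : expR (g p / 2) *: ycoord p = expR (- (cr w j / 2)) *: cy w j /\
    ycoord (phi p) = expR (- (cr w j / 2)) *: cy w (ordS j).
  apply: half_sum_diff; first by rewrite -qy.
  by rewrite -opprB -fx -scalerN opprB.
have gp : g p = cr w (ord_pred j) - cr w j.
  by apply: expR_inj; rewrite -st ft subrK.
have scale_p (q r : 'rV[R]_n) :
    expR (g p / 2) *: q = expR (- (cr w j / 2)) *: r ->
    q = expR (- (cr w (ord_pred j) / 2)) *: r.
  move=> qr; rewrite -[q](scalerK (lt0r_neq0 (expR_gt0 (g p / 2)))) qr scalerA.
  rewrite -expRN -expRD gp; congr (expR _ *: _); ring.
have pE : p = chain_point w j.
  rewrite /chain_point -(scale_p _ _ ex) -(scale_p _ _ ey).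
  by rewrite -[ctheta w _]/(tcoord (sample w j).1) qt; case: (p) => [[]].
rewrite /realizes -pE; split=> //.
rewrite /chain_point ordSK /reeb_flow px py; congr (_, _, _).
have tp : ctheta w (ordS j) = tcoord p by rewrite -qt.
move: Ft; rewrite (slope_area sx sy) fv (jet_area ex ey px py) tp => <-.
by field.
Qed.

Lemma realizes_link w t j : realizes w t j -> link F w t j.
Proof.
case=> fz /i_F_GammaP[_]; set p := chain_point w j.
rewrite -/(slope F w j) => -[fx fy ft fv] gp pS.
have scale_p (q : 'rV[R]_n) : expR (g p / 2) *:
    (expR (- (cr w (ord_pred j) / 2)) *: q) = expR (- (cr w j / 2)) *: q.
  by rewrite scalerA -expRD gp; congr (expR _ *: _); field.
have px : xcoord (phi p) = expR (- (cr w j / 2)) *: cx w (ordS j).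
  by have := congr1 (@xcoord R n) pS; rewrite {1}/chain_point ordSK.
have py : ycoord (phi p) = expR (- (cr w j / 2)) *: cy w (ordS j).
  by have := congr1 (@ycoord R n) pS; rewrite {1}/chain_point ordSK.
have pth : ctheta w (ordS (ordS j)) = tcoord (phi p) - t.
  by have := congr1 (@tcoord R n) pS.
have sx : xcoord (slope F w j)
    = expR (- (cr w j / 2)) *: (cy w j - cy w (ordS j)).
  by rewrite fx py -[ycoord p]/(_ *: _) scale_p -scalerBr.
have sy : ycoord (slope F w j)
    = expR (- (cr w j / 2)) *: (cx w (ordS j) - cx w j).
  by rewrite fy px -[xcoord p]/(_ *: _) scale_p -scalerBr.
have st : tcoord (slope F w j) + 1 = expR (cr w (ord_pred j) - cr w j).
  by rewrite ft subrK gp.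
split=> //; rewrite (slope_area sx sy) fv.
rewrite (jet_area (scale_p _) (scale_p _) px py) pth.
by rewrite -[tcoord p]/(ctheta w (ordS j)); field.
Qed.

Lemma realizes_translated_chain w t :
  (forall j, realizes w t j) -> translated_chain phi g t (chain_point w).
Proof.
move=> rw; split=> [|j]; last by case: (rw j).
transitivity (\sum_j (cr w (ord_pred j) - cr w j)).
  by apply: eq_bigr => j _; case: (rw j).
rewrite sumrB -(sum_ordS (fun j => cr w (ord_pred j))).
by under eq_bigr do rewrite ordSK; rewrite subrr.
Qed.

(** The conformal factors integrate to the r_j, the generating function provides
the zeta_j, and the remaining coordinates invert [chain_point]. *)
Lemma translated_chain_realized t (p : 'I_k -> pt R n) :
  range (Gamma phi g) `<=` i_F F @` [set z | fibre_derivative F z = 0] ->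
  translated_chain phi g t p ->
  exists2 w, chain_point w = p & forall j, realizes w t j.
Proof.
move=> GF [/cyclic_potential[r rE] pS].
have /choice[z zE] j : exists z, fibre_derivative F z = 0 /\
    i_F F z = Gamma phi g (p j).
  by have [z] := GF _ (imageP (Gamma phi g) (I : setT (p j))); exists z.
pose w : config R n N k := config_of_rows
  (fun j => expR (r (ord_pred j) / 2) *: xcoord (p j))
  (fun j => expR (r (ord_pred j) / 2) *: ycoord (p j))
  (fun j => tcoord (p (ord_pred j))) r (fun j => (z j).2).
have wp : chain_point w = p.
  apply/funext => j; rewrite /chain_point !rowsE ordSK !scalerA -!expRD addNr.
  by rewrite expR0 !scale1r; case: (p j) => [[]].
have wz j : sample w j = z j.
  have [[xz yz tz] _] := (i_F_GammaP _ _).1 (zE j).2.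
  rewrite /sample !rowsE !ordSK pS.
  rewrite [RHS]surjective_pairing [(z j).1]surjective_pairing.
  rewrite [(z j).1.1]surjective_pairing.
  rewrite -[_.1.1.1]/(xcoord (z j).1) -[_.1.1.2]/(ycoord (z j).1).
  rewrite -[_.1.2]/(tcoord (z j).1) xz yz tz.
  rewrite -[xcoord (reeb_flow _ _)]/(xcoord (phi (p j))).
  rewrite -[ycoord (reeb_flow _ _)]/(ycoord (phi (p j))).
  rewrite ![expR _ *: (2^-1 *: _)]scalerA ![expR _ * 2^-1]mulrC -!scalerA.
  rewrite ![expR _ *: (_ + _)]scalerDr !scalerA -!expRD addNr expR0 !scale1r.
  rewrite -rE; do 2!congr (_, _); congr (_, _).
    by congr (_ *: (expR _ *: _ + _)); field.
  by congr (_ *: (expR _ *: _ + _)); field.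
exists w => // j; rewrite /realizes wp wz !rowsE rE.
by split; case: (zE j).
Qed.

(** Both families r and r' have the increments prescribed by g along the same
chain, so they differ by a constant c; injectivity of i_F on the fibre-critical
set then identifies the zeta_j. *)
Lemma chain_point_inj w w' t t' :
  (0 < k)%N ->
  set_inj [set z | fibre_derivative F z = 0] (i_F F) ->
  (forall j, realizes w t j) -> (forall j, realizes w' t' j) ->
  chain_point w = chain_point w' -> exists c, w' = R_action c w.
Proof.
move=> k0 Finj rw rw' ww'.
pose c := cr w' (Ordinal k0) - cr w (Ordinal k0).
have cE j : cr w' j = cr w j + c.
  suff -> : c = cr w' j - cr w j by rewrite subrKC.
  apply: (cyclic_const (f := fun j => cr w' j - cr w j)) => l.
  have [_ _ gl _] := rw (ordS l); have [_ _ gl' _] := rw' (ordS l).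
  move: gl; rewrite ww' gl' ordSK => gl.
  by lra.
exists c; apply: config_eqP => j; rewrite !R_actionE.
have pj := congr1 (@^~ j) ww'.
have scale_eq (q q' : 'rV[R]_n) : expR (- (cr w (ord_pred j) / 2)) *: q
    = expR (- (cr w' (ord_pred j) / 2)) *: q' -> q' = expR (c / 2) *: q.
  move=> qq'.
  apply: (scalerI (lt0r_neq0 (expR_gt0 (- (cr w' (ord_pred j) / 2))))).
  by rewrite -qq' scalerA -expRD cE; congr (expR _ *: _); field.
split.
- exact: scale_eq (congr1 (@xcoord R n) pj).
- exact: scale_eq (congr1 (@ycoord R n) pj).
- have := congr1 (fun p => tcoord (p (ord_pred j))) ww'.
  by rewrite /tcoord /= ord_predK.
- exact: cE.
have [z0 zG _ _] := rw j; have [z0' zG' _ _] := rw' j.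
have : sample w' j = sample w j.
  apply: (Finj _ _ (mem_set z0') (mem_set z0)).
  by apply: (etrans zG'); rewrite -pj; exact: esym zG.
by move=> /(congr1 snd).
Qed.

End Chains.

Theorem proposition5p4 (R : realType) (n N k : nat)
    (phi : pt R n -> pt R n) (g : pt R n -> R)
    (F : pt R n * 'rV[R]_N -> R)
    (hk : odd k)
    (hphi : contactomorphism phi)
    (hg : conformal_factor phi g)
    (hF : generating_function_of phi g F) :
  (forall (c : R) (w : config R n N k),
     P_F F (R_action c w) = P_F F w) /\
  exists corr : set (config R n N k) -> ('I_k -> pt R n),
    set_bij (critical_orbits (P_F (k := k) F))
            [set p | exists t, translated_chain phi g t p] corr /\
    forall (O : set (config R n N k)) (w : config R n N k) (t : R),
      critical_orbits (P_F (k := k) F) O -> O w ->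
      translated_chain phi g t (corr O) ->
      P_F F w = t * k%:R.
Proof.
have [[smoothF _] [_ Finj _ _] FG] := hF.
have dF z : differentiable F z by have [] := smoothF 1%N.
have k0 : (0 < k)%N by case: (k) hk.
split=> [c w|]; first exact: P_F_R_action.
have critP w : critical_point (P_F (k := k) F) w <->
    forall j, realizes F phi g w (level F w) j.
  rewrite critical_linkP//; split=> lw j.
    by apply: link_realizes => //; rewrite FG.
  exact: realizes_link (lw j).
have realE (w : config R n N k) t :
    (forall j, realizes F phi g w t j) -> level F w = t.
  by move=> rw; exact: link_level k0 (fun j => realizes_link (rw j)).
(* chain_point is constant on orbits, so any representative of O will do. *)
pose corr (O : set (config R n N k)) := chain_point (get O).
have corrE w : corr (orbit_of w) = chain_point w.
  rewrite /corr; have [c _ <-] : orbit_of w (get (orbit_of w)).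
    exact: getI (orbit_of_refl w).
  exact: chain_point_R_action.
exists corr; split.
  split.
  - move=> _ [w /critP rw <-]; rewrite corrE; exists (level F w).
    exact: realizes_translated_chain rw.
  - move=> _ _ /set_mem[w /critP rw <-] /set_mem[w' /critP rw' <-].
    rewrite !corrE => ww'.
    have [c ->] := chain_point_inj k0 Finj rw rw' ww'.
    by rewrite orbit_of_R_action.
  - move=> p [t tp]; have [|w wp rw] := translated_chain_realized (F := F) _ tp.
      by rewrite FG.
    exists (orbit_of w); last by rewrite corrE.
    by exists w => //; apply/critP; rewrite (realE _ _ rw).
move=> _ w t [w0 /critP rw0 <-] [c _ <-]; rewrite corrE P_F_R_action => -[_ tp].
have [_ tp0] := realizes_translated_chain rw0.
(* The time of a chain is determined by its points: it is the height of phi(p_1)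
   minus that of p_2. *)
rewrite P_FE mulrC; congr (_ * _).
have := tp (Ordinal k0); rewrite tp0.
by move=> /(congr1 (@tcoord R n)) /addrI /oppr_inj.
Qed.
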